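(* Let $K$ be a positive integer, and let $(a(n))_{n\ge 1}$ be the sequence of rational numbers defined by the initial conditions $a(m)=1$ for $1\le m\le 2K+1$ and, for all $n\ge 2K+2$, by the quadratic recurrence $$a(n)\,a(n-(2K+1)) = a(n-1)\,a(n-2K)+a(n-K)+a(n-K-1).$$ Then for all $n\ge 6K+2$ the sequence also satisfies the linear recurrence $$a(n)=\left(2K^2+8K+4\right)\bigl(a(n-2K)-a(n-4K)\bigr)+a(n-6K).$$ (Equivalently, the sequence is the one generated by this linear recurrence for $n\ge 6K+2$ with its initial $6K+1$ values taken to be the first $6K+1$ values of the sequence given by the quadratic recurrence.)
   Context: The quadratic recurrence determines $a(n)$ by dividing by $a(n-(2K+1))$, i.e. $a(n)=\bigl(a(n-1)a(n-2K)+a(n-K)+a(n-K-1)\bigr)/a(n-(2K+1))$. *)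

(* Defs.v *)
From mathcomp Require Import all_boot all_order all_algebra.

(* Main.v *)
Require Import Defs.
From mathcomp Require Import all_boot all_order all_algebra.
From mathcomp Require Import zify ring lra.
Import GRing.Theory.
Local Open Scope ring_scope.

(** Cut the sequence into blocks of length [2K], writing [n = 1 + r + 2Kq] with
    [0 <= r <= 2K].  The recurrence is reversible, and the initial values are
    symmetric under reversal, so the block [q = -1] is the mirror image of the
    block [q = 1]; both are explicit, piecewise quadratic in [r].  For each [r]
    let [w r] be the sequence which agrees with [a] on the blocks [-1] and [0]
    and satisfies
      [w r (q+2) = T * w r (q+1) - w r q + J r],
    with [T = 2K^2 + 8K + 3] and [J r = 2r^2 - 4Kr - 4K - 1].  The defect of the
    quadratic recurrence then changes from one block to the next by an
    expression linear in [w], which itself satisfies the homogeneous recurrence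
    [l (q+2) = T * l (q+1) - l q], hence vanishes once it does so on two blocks.
    So [w] satisfies the quadratic recurrence and coincides with [a];
    eliminating [J r] between two consecutive blocks gives the linear
    recurrence. *)

Fixpoint affrec {R : pzRingType} (t j x0 x1 : R) (q : nat) : R :=
  if q is q'.+1 then affrec t j x1 (t * x1 - x0 + j) q' else x0.

Lemma affrecSS {R : pzRingType} (t j x0 x1 : R) q :
  affrec t j x0 x1 q.+2
    = t * affrec t j x0 x1 q.+1 - affrec t j x0 x1 q + j.
Proof. by elim: q x0 x1 => [|q IHq] x0 x1 //=; rewrite -IHq. Qed.

(** The Casoratian grows by [jy * x q.+1 - jx * y q.+1]. In this combination the inhomogeneous terms
    cancel, so it obeys the homogeneous recurrence, as do the differences of [z]; agreement at two
    consecutive indices is enough. *)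
Lemma affrec_casoratian {R : comPzRingType} {t jx jy jz : R} {x y z : nat -> R} :
    (forall q, x q.+2 = t * x q.+1 - x q + jx) ->
    (forall q, y q.+2 = t * y q.+1 - y q + jy) ->
    (forall q, z q.+2 = t * z q.+1 - z q + jz) ->
    x 0%N * y 1%N - y 0%N * x 1%N = z 0%N ->
    jy * x 1%N - jx * y 1%N = z 1%N - z 0%N ->
    jy * x 2 - jx * y 2 = z 2 - z 1%N ->
  forall q, x q * y q.+1 - y q * x q.+1 = z q.
Proof.
move=> xE yE zE Q0 L0 L1.
have L q : jy * x q.+1 - jx * y q.+1 = z q.+1 - z q
        /\ jy * x q.+2 - jx * y q.+2 = z q.+2 - z q.+1.
  elim: q => [|q [IH0 IH1]]; split=> //.
  have -> : jy * x q.+3 - jx * y q.+3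
      = t * (jy * x q.+2 - jx * y q.+2) - (jy * x q.+1 - jx * y q.+1).
    by rewrite (xE q.+1) (yE q.+1); ring.
  by rewrite IH0 IH1 (zE q.+1) (zE q); ring.
elim=> [|q IHq] //.
have -> : x q.+1 * y q.+2 - y q.+1 * x q.+2
    = (x q * y q.+1 - y q * x q.+1) + (jy * x q.+1 - jx * y q.+1).
  by rewrite xE yE; ring.
by rewrite IHq (proj1 (L q)); ring.
Qed.

Section Blocks.
Variable K : nat.
Let k : rat := K%:R.

Definition trace_coef : rat := 2 * k ^+ 2 + 8 * k + 3.

Definition drift (r : nat) : rat :=
  2 * r%:R ^+ 2 - 4 * k * r%:R - 4 * k - 1.

Definition mirror_block (r : nat) : rat :=
  if (r <= K)%N then 2 * k + 1 + 2 * (k - r%:R) * (k - r%:R + 1)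
  else 1 + 2 * (2 * k - r%:R).

(* The block number is shifted by one: [block r q] is the value at index
   [1 + r + 2K(q - 1)]. *)
Definition block (r q : nat) : rat :=
  affrec trace_coef (drift r) (mirror_block r) 1 q.

Lemma mirror_block_lo r : (r <= K)%N ->
  mirror_block r = 2 * k + 1 + 2 * (k - r%:R) * (k - r%:R + 1).
Proof. by rewrite /mirror_block => ->. Qed.

Lemma mirror_block_hi i : mirror_block (K + i) = 1 + 2 * (k - i%:R).
Proof.
rewrite /mirror_block; case: leqP => [le_i|_]; rewrite natrD -/k; last by ring.
(* The two pieces agree at [r = K]. *)
by have -> : i = 0%N by [lia]; ring.
Qed.

Lemma block0 r : block r 0 = mirror_block r. Proof. by []. Qed.
Lemma block1 r : block r 1 = 1. Proof. by []. Qed.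
Lemma blockSS r q :
  block r q.+2 = trace_coef * block r q.+1 - block r q + drift r.
Proof. exact: affrecSS. Qed.

(** Consecutive blocks overlap in one index. The two sides share a recurrence because [drift] is
    symmetric about [r = K]. *)
Lemma block_wrap q : block (2 * K) q = block 0 q.+1.
Proof.
suff: block (2 * K) q = block 0 q.+1 /\ block (2 * K) q.+1 = block 0 q.+2.
  by case.
elim: q => [|q [IH0 IH1]]; split=> //.
- by rewrite block0 block1 mul2n -addnn mirror_block_hi -/k; ring.
- rewrite blockSS !block1 block0 mirror_block_lo // /trace_coef /drift.
  by ring.
- rewrite (blockSS (2 * K) q) (blockSS 0 q.+1) IH0 IH1 /drift natrM -/k.
  by ring.
Qed.

(** The quadratic recurrence at [n = 2 + r + 2Kq], where the shift by [K] leads back into the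
    previous block. *)
Lemma block_lo r q : (r < K)%N ->
  block r q * block r.+1 q.+1 - block r.+1 q * block r q.+1
    = block (K + r) q + block (K + r.+1) q.
Proof.
move=> lt_r.
apply: (affrec_casoratian (z := fun q => block (K + r) q + block (K + r.+1) q)
   (jz := drift (K + r) + drift (K + r.+1)) (blockSS r) (blockSS r.+1)).
- by move=> p; rewrite !blockSS; ring.
all: rewrite ?blockSS ?block1 ?block0 ?mirror_block_hi ?mirror_block_lo //;
  try exact: ltnW.
all: by rewrite /trace_coef /drift ?natrD -?natr1 -/k; ring.
Qed.

(** The other half of the block: here [n - K] and [n - K - 1] stay in the block of [n]. *)
Lemma block_hi i q : (i < K)%N ->
  block (K + i) q * block (K + i.+1) q.+1
    - block (K + i.+1) q * block (K + i) q.+1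
    = block i q.+1 + block i.+1 q.+1.
Proof.
move=> lt_i.
apply: (affrec_casoratian (z := fun q => block i q.+1 + block i.+1 q.+1)
   (jz := drift i + drift i.+1) (blockSS (K + i)) (blockSS (K + i.+1))).
- by move=> p; rewrite !(blockSS _ p.+1); ring.
all: rewrite ?blockSS ?block1 ?block0 ?mirror_block_hi ?mirror_block_lo //;
  try exact: ltnW.
all: by rewrite /trace_coef /drift ?natrD -?natr1 -/k; ring.
Qed.

End Blocks.

Theorem lemma2 (K : nat) (hK : (0 < K)%N) (a : nat -> rat)
  (a_init : forall m : nat, (1 <= m <= 2 * K + 1)%N -> a m = 1)
  (a_rec : forall n : nat, (2 * K + 2 <= n)%N ->
     a n * a (n - (2 * K + 1))%N
       = a (n - 1)%N * a (n - 2 * K)%N + a (n - K)%N + a (n - K - 1)%N) :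
  forall n : nat, (6 * K + 2 <= n)%N ->
    a n = (2 * K ^ 2 + 8 * K + 4)%N%:R
            * (a (n - 2 * K)%N - a (n - 4 * K)%N)
          + a (n - 6 * K)%N.
Proof.
(* Positivity allows cancelling [a (n - (2K + 1))], so the quadratic recurrence determines [a n]. *)
have a_gt0 n : (0 < n)%N -> 0 < a n.
  elim/ltn_ind: n => n IH n_gt0.
  have [le_n|lt_n] := leqP n (2 * K + 1); first by rewrite a_init ?n_gt0.
  have a'_gt0 : 0 < a (n - (2 * K + 1))%N by apply: IH; lia.
  rewrite -(Num.Theory.pmulr_lgt0 _ a'_gt0) a_rec; last by lia.
  by rewrite !Num.Theory.addr_gt0 ?Num.Theory.mulr_gt0 // IH //; lia.
have aE q r : (r <= 2 * K)%N -> a (1 + r + 2 * K * q)%N = block K r q.+1.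
  elim: q r => [|q IHq] r le_r; first by rewrite a_init ?block1 //; lia.
  elim/ltn_ind: r le_r => -[|r] IHr le_r.
    by rewrite -block_wrap -IHq //; congr (a _); lia.
  have a_nz : a (1 + r + 2 * K * q)%N != 0 by rewrite Num.Theory.lt0r_neq0 ?a_gt0.
  apply: (mulIf a_nz).
  have [n nE] : {n | n = 1 + r.+1 + 2 * K * q.+1}%N by eexists.
  rewrite -nE; have := a_rec n.
  have -> : (n - (2 * K + 1) = 1 + r + 2 * K * q)%N by lia.
  have -> : (n - 1 = 1 + r + 2 * K * q.+1)%N by lia.
  have -> : (n - 2 * K = 1 + r.+1 + 2 * K * q)%N by lia.
  move=> -> //; last by lia.
  rewrite IHr ?(IHq r) ?(IHq r.+1) //; try lia.
  have [lt_r|ge_r] := ltnP r K.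
    have -> : (n - K = 1 + (K + r.+1) + 2 * K * q)%N by lia.
    have -> : (1 + (K + r.+1) + 2 * K * q - 1 = 1 + (K + r) + 2 * K * q)%N by lia.
    rewrite !IHq; try lia.
    by have := block_lo K r q.+1 lt_r; lra.
  have [i rE] : {i | r = K + i}%N by exists (r - K)%N; lia.
  have lt_i : (i < K)%N by lia.
  have -> : (n - K = 1 + i.+1 + 2 * K * q.+1)%N by lia.
  have -> : (1 + i.+1 + 2 * K * q.+1 - 1 = 1 + i + 2 * K * q.+1)%N by lia.
  rewrite !IHr; try lia.
  by have := block_hi K i q.+1 lt_i; rewrite rE -addnS; lra.
move=> n le_n.
have [q [r [le_r nE]]] :
    exists q r, (r <= 2 * K)%N /\ n = (1 + r + 2 * K * q.+3)%N.
  exists ((n - 1) %/ (2 * K) - 3)%N, ((n - 1) %% (2 * K))%N.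
  have K2_gt0 : (0 < 2 * K)%N by lia.
  have q_ge3 : (3 <= (n - 1) %/ (2 * K))%N by rewrite leq_divRL //; lia.
  split; first by rewrite ltnW ?ltn_pmod.
  have := divn_eq (n - 1) (2 * K).
  have -> : (((n - 1) %/ (2 * K) - 3).+3 = (n - 1) %/ (2 * K))%N by lia.
  by lia.
have -> : (n - 2 * K = 1 + r + 2 * K * q.+2)%N by lia.
have -> : (n - 4 * K = 1 + r + 2 * K * q.+1)%N by lia.
have -> : (n - 6 * K = 1 + r + 2 * K * q)%N by lia.
rewrite nE !aE // (blockSS K r q.+2) (blockSS K r q.+1) /trace_coef.
by rewrite !natrD !natrM; ring.
Qed.
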